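(* Let $H$ be a connected graph with at least one edge. Then: 1. $\mathsf{OEI}(H)\ge\lceil(|V(H)|-1)/2\rceil$. 2. $\mathsf{OEI}(H)\ge\delta(H)+1$, where $\delta(H):=\max_{S\subseteq V(H)}\big(|S|-|\{j\in V(H):\exists i\in S\text{ such that }(ji)\in E(H)\}|\big)$.
   Context: Let $H$ be a connected (finite, simple) graph on $k$ vertices and $\pi$ a bijective labelling of its vertices by $\{1,\dots,k\}$; identify vertices with their labels, and write an edge between $u$ and $v$ as $(uv)$ when $u>v$. For $F\subseteq E(H)$, an edge $(uv)\in E(H)\setminus F$ (so $u>v$) is covered by $F$ if some edge of $F$ has $u$ as an endpoint; $\partial^\pi_HF$ is the set of edges covered by $F$. $\mathsf{OEI}_\pi(H)$ is the minimum size of $F\subseteq E(H)$ with $F\cup\partial^\pi_HF=E(H)$, and $\mathsf{OEI}(H)=\max_\pi\mathsf{OEI}_\pi(H)$. *)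

(* Defs.v *)
From mathcomp Require Import all_boot all_order all_algebra.
Set Implicit Arguments.
Unset Strict Implicit.
Unset Printing Implicit Defensive.
Import Order.TTheory GRing.Theory Num.Theory.

(** A finite simple graph is a symmetric irreflexive relation [e] on a finite
    type [V]; its edges are the unordered pairs [[set u; v]] with [e u v]. *)

Section Graph.
Variables (V : finType) (e : rel V).

Definition connected_graph : Prop := forall x y : V, connect e x y.

Definition edges : {set {set V}} :=
  [set A : {set V} | [exists u, exists v, e u v && (A == [set u; v])]].

Definition nbhd (S : {set V}) : {set V} := [set j | [exists i in S, e j i]].

(** The difference is taken in [int], where it may be negative. *)
Definition deficiency (S : {set V}) : int := (#|S|%:Z - #|nbhd S|%:Z)%R.

(** [set0] only witnesses that the range of the maximum is nonempty. *)
Definition delta : int := deficiency [arg max_(S > set0) deficiency S]%O.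

(** A labelling is an injective [pi : {ffun V -> 'I_#|V|}], hence a bijection.
    Labels are shifted from {1, ..., k} to {0, ..., k-1}: only their order is
    used. In [covered], the covering edge may have [u] as either endpoint. *)
Definition covered (pi : {ffun V -> 'I_#|V|}) (F : {set {set V}}) :
    {set {set V}} :=
  [set A in edges :\: F |
    [exists u, exists v,
      [&& A == [set u; v], pi v < pi u & [exists B in F, u \in B]]]].

Definition oei_set (pi : {ffun V -> 'I_#|V|}) : {set {set {set V}}} :=
  [set F : {set {set V}} | (F \subset edges) & (F :|: covered pi F == edges)].

Lemma oei_set_edges pi : edges \in oei_set pi.
Proof.
rewrite inE subxx /=; apply/eqP/setP => A.
by rewrite !inE; case: [exists u, [exists v, e u v && _]].
Qed.

(** By [oei_set_edges] the minimum ranges over a nonempty family. *)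
Definition OEI_label (pi : {ffun V -> 'I_#|V|}) : nat :=
  #|[arg min_(F < edges in oei_set pi) #|F|]|.

(** Labellings exist ([enum_rank] is one), so the default value 0 of [\max] is
    never used in place of a labelling. *)
Definition OEI : nat :=
  \max_(pi : {ffun V -> 'I_#|V|} | injectiveb pi) OEI_label pi.

End Graph.

(* Main.v *)
Require Import Defs.
From mathcomp Require Import all_boot all_order all_algebra.
From mathcomp Require Import zify.

(** Fix a labelling.  If a vertex [u] has a neighbour [v] with a smaller label,
    then an admissible family [F] either contains the edge [uv] or covers it
    through an edge of [F] at [u]; in both cases [F] touches [u]
    ([oei_set_touches]).  Hence, if every vertex of a set [S] has a neighbour
    with a smaller label and every edge meets [S] in at most [k] vertices, then
    [#|S| <= k * #|F|] ([leq_card_OEI]).  Both bounds follow by choosing the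
    labelling and [S].

    For the first bound, list the vertices so that each one but the first has
    an earlier neighbour, which connectedness allows ([connected_listing]), and
    let [S] be all vertices but the first; every edge meets [S] in at most two
    vertices, so [#|V| - 1 <= 2 * OEI e].

    For the second bound, give the largest labels to an independent set [S].
    No vertex is isolated, so every vertex of [S] has a neighbour, which has a
    smaller label since it lies outside [S]; every edge meets [S] at most once,
    so [#|S| <= OEI e] ([leq_card_independent_OEI]).  Finally, removing from an
    arbitrary [S] the vertices of its neighbourhood leaves an independent set
    whose deficiency is at least that of [S] ([deficiency_independent_part]),
    and a nonempty independent set has a nonempty neighbourhood, so that its
    size exceeds its deficiency. *)

Section Bounds.

Local Set Implicit Arguments.
Local Unset Strict Implicit.
Local Unset Printing Implicit Defensive.

Variables (V : finType) (e : rel V).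
Hypotheses (e_sym : symmetric e) (e_irr : irreflexive e).

Lemma edge_in_edges u v : e u v -> [set u; v] \in edges e.
Proof.
by move=> euv; rewrite inE; apply/existsP; exists u; apply/existsP; exists v;
  rewrite euv eqxx.
Qed.

Lemma oei_set_touches (pi : {ffun V -> 'I_#|V|}) F u v :
  F \in oei_set e pi -> e u v -> (pi v < pi u)%N -> u \in cover F.
Proof.
rewrite inE => /andP[_ /eqP FE] euv lt_vu.
have := edge_in_edges euv; rewrite -FE inE => /orP[AF|].
  by apply/bigcupP; exists [set u; v]; rewrite // !inE eqxx.
rewrite inE => /andP[_] /existsP[x] /existsP[y] /and3P[/eqP uvxy lt_yx].
move=> /existsP[B /andP[BF xB]].
suff <- : x = u by apply/bigcupP; exists B.
have: x \in [set u; v] by rewrite uvxy !inE eqxx.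
have: y \in [set u; v] by rewrite uvxy !inE eqxx orbT.
rewrite !inE => /orP[] /eqP yE /orP[] /eqP xE //; subst x y.
  by move: lt_yx; rewrite ltnNge (ltnW lt_vu).
by rewrite ltnn in lt_yx.
Qed.

(** A duplicate-free list of all the vertices gives the labelling by
    position. *)
Lemma labelling_of_listing (s : seq V) :
  uniq s -> (forall x, x \in s) ->
  exists2 pi : {ffun V -> 'I_#|V|},
    injective pi & forall x, pi x = index x s :> nat.
Proof.
move=> s_uniq s_all.
have szs : size s = #|V| by rewrite -(card_uniqP s_uniq); apply: eq_card.
have lt_s x : (index x s < #|V|)%N by rewrite -szs index_mem.
exists [ffun x => Ordinal (lt_s x)] => [x y|x]; rewrite !ffunE //.
by move=> /(congr1 val) /= /index_inj; apply.
Qed.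

(** Count the elements of [S] by the members of [F] that contain them. *)
Lemma leq_card_traces (T : finType) (S : {set T}) (F : {set {set T}}) k :
  S \subset cover F -> (forall A, A \in F -> #|A :&: S| <= k)%N ->
  (#|S| <= k * #|F|)%N.
Proof.
move=> SF Sk; pose P := [set A :&: S | A in F].
have SP : S \subset cover P.
  apply/subsetP => x xS; have /bigcupP[A AF xA] := subsetP SF x xS.
  by apply/bigcupP; exists (A :&: S); [exact: imset_f | rewrite inE xA].
apply: leq_trans (subset_leq_card SP) _.
apply: leq_trans (leq_card_cover P) _.
apply: (@leq_trans (\sum_(B in P) k)%N).
  by apply: leq_sum => _ /imsetP[A AF ->]; apply: Sk.
by rewrite sum_nat_const mulnC leq_mul2l leq_imset_card orbT.
Qed.

Lemma leq_card_OEI (s : seq V) (S : {set V}) k :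
  uniq s -> (forall x, x \in s) ->
  (forall u, u \in S -> exists2 v, e u v & (index v s < index u s)%N) ->
  (forall A, A \in edges e -> #|A :&: S| <= k)%N ->
  (#|S| <= k * OEI e)%N.
Proof.
move=> s_uniq s_all S_back Sk.
have [pi pi_inj piE] := labelling_of_listing s_uniq s_all.
have le_pi : (OEI_label e pi <= OEI e)%N.
  by rewrite /OEI (bigD1 pi) ?leq_maxl //; apply/injectiveP.
apply: leq_trans (leq_mul (leqnn k) le_pi).
rewrite /OEI_label; case: arg_minnP => [|F FE _]; first exact: oei_set_edges.
apply: leq_card_traces.
  apply/subsetP => u uS; have [v euv lt_vu] := S_back u uS.
  by apply: oei_set_touches FE euv _; rewrite !piE.
move=> A AF; apply: Sk; move: FE; rewrite inE => /andP[/subsetP FE _].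
exact: FE.
Qed.

Lemma card_edge A : A \in edges e -> (#|A| <= 2)%N.
Proof.
rewrite inE => /existsP[u] /existsP[v] /andP[_ /eqP ->].
by rewrite cards2; case: (u != v).
Qed.

Lemma exists_boundary_edge (S : {set V}) x y :
  connected_graph e -> x \in S -> y \notin S ->
  exists u v, [/\ u \notin S, v \in S & e u v].
Proof.
move=> e_conn xS yS.
have [/existsP[u /existsP[v /and3P[uS vS euv]]]|noE] :=
  boolP [exists u, exists v, [&& u \notin S, v \in S & e u v]].
  by exists u, v.
(* Otherwise [S] is closed under adjacency, hence contains [y]. *)
have S_closed : closed e (mem S).
  apply: (intro_closed (sym_connect_sym e_sym)) => v u evu vS.
  apply: contraNT noE => uS; apply/existsP; exists u; apply/existsP; exists v.
  by rewrite uS vS e_sym.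
by move: yS; rewrite -(closed_connect S_closed (e_conn x y)) xS.
Qed.

(** The list is grown from [r] by one vertex at a time, each adjacent to an
    earlier one. *)
Lemma connected_listing (r : V) :
  connected_graph e ->
  exists2 s : seq V, uniq s /\ (forall x, x \in s) &
    forall u, u != r -> exists2 v, e u v & (index v s < index u s)%N.
Proof.
move=> e_conn.
have grow n : (n < #|V|)%N -> exists s : seq V,
    [/\ uniq s, size s = n.+1, r \in s &
      forall u, u \in s -> u != r ->
        exists2 v, e u v & (index v s < index u s)%N].
  elim: n => [_|n IHn lt_n].
    exists [:: r]; split; rewrite ?inE // => u.
    by rewrite inE => /eqP-> /eqP.
  have [s [s_uniq szs rs s_back]] := IHn (ltnW lt_n).
  have [y ys] : exists y, y \notin s.
    apply/existsP; apply: contraLR lt_n => /existsPn s_all.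
    rewrite -leqNgt -szs -(card_uniqP s_uniq) subset_leq_card //.
    by apply/subsetP => x _; have := s_all x; rewrite negbK.
  have [||u [v []]] := @exists_boundary_edge [set x in s] r y e_conn;
    rewrite ?inE // => us vs euv.
  exists (rcons s u); split.
  - by rewrite rcons_uniq us.
  - by rewrite size_rcons szs.
  - by rewrite mem_rcons inE rs orbT.
  move=> w; rewrite mem_rcons inE => /orP[/eqP-> _|ws wr].
    exists v => //; rewrite -cats1 !index_cat vs (negPf us) /= eqxx addn0.
    by rewrite index_mem.
  have [x ewx lt_xw] := s_back w ws wr; exists x => //.
  have xs : x \in s by rewrite -index_mem (ltn_trans lt_xw) ?index_mem.
  by rewrite -cats1 !index_cat xs ws.
have V_gt0 : (0 < #|V|)%N by apply/card_gt0P; exists r.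
have [|s [s_uniq szs rs s_back]] := grow #|V|.-1; first by rewrite prednK.
rewrite prednK // in szs.
have s_all x : x \in s.
  have /eqP eq_s : #|s| == #|V| by rewrite (card_uniqP s_uniq) szs.
  by have /subset_cardP := eq_s => /(_ (subset_predT _)) ->.
by exists s => // u; apply: s_back.
Qed.

Lemma leq_uphalf_OEI :
  connected_graph e -> (uphalf (#|V| - 1) <= OEI e)%N.
Proof.
move=> e_conn; case: (posnP #|V|) => [->//|/card_gt0P[r _]].
have [s [s_uniq s_all] s_back] := connected_listing r e_conn.
have : (#|[set~ r]| <= 2 * OEI e)%N.
  apply: (leq_card_OEI s_uniq s_all) => [u|A AE].
    by rewrite !inE; apply: s_back.
  by apply: leq_trans (card_edge AE); rewrite subset_leq_card ?subsetIl.
by rewrite cardsC1; lia.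
Qed.

Lemma connected_no_isolated (x : V) :
  connected_graph e -> (exists u v, e u v) -> exists y, e x y.
Proof.
move=> e_conn [u [v euv]].
have [y yx] : exists y, y != x.
  case: (eqVneq u x) => [ux|ux]; last by exists u.
  by exists v; rewrite -ux; apply: contraTneq euv => ->; rewrite e_irr.
have [||w [z [_]]] := @exists_boundary_edge [set x] x y e_conn;
  rewrite ?inE // => /eqP-> ewx.
by exists w; rewrite e_sym.
Qed.

Lemma leq_card_independent_OEI (S : {set V}) :
  (forall x, exists y, e x y) -> {in S &, forall x y, ~~ e x y} ->
  (#|S| <= OEI e)%N.
Proof.
move=> e_nbr S_ind; rewrite -[OEI e]mul1n.
apply: (@leq_card_OEI (enum (~: S) ++ enum S)).
- rewrite cat_uniq !enum_uniq andbT /=; apply/hasPn => x.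
  by rewrite !mem_enum inE negbK.
- by move=> x; rewrite mem_cat !mem_enum inE orNb.
- move=> u uS; have [v euv] := e_nbr u; exists v => //.
  have vS : v \notin S by apply: contraL euv => vS; apply: S_ind.
  rewrite !index_cat !mem_enum !inE vS uS /=.
  by rewrite ltn_addr // index_mem mem_enum inE.
move=> A; rewrite inE => /existsP[u] /existsP[v] /andP[euv /eqP ->].
apply/card_le1_eqP => x y; rewrite !inE.
move=> /andP[/orP[]/eqP-> xS] /andP[/orP[]/eqP-> yS] //.
  by have := S_ind _ _ xS yS; rewrite euv.
by have := S_ind _ _ xS yS; rewrite e_sym euv.
Qed.

Lemma independent_part (S : {set V}) :
  {in S :\: nbhd e S &, forall x y, ~~ e x y}.
Proof.
move=> x y; rewrite !inE => /andP[xN xS] /andP[_ yS].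
by apply: contra xN => exy; apply/existsP; exists y; rewrite yS.
Qed.

(** The neighbourhood of the independent part lies in [nbhd e S :\: S], so
    that both terms of the deficiency lose at least [#|S :&: nbhd e S|], the
    first one exactly so. *)
Lemma deficiency_independent_part (S : {set V}) :
  (deficiency e S <= deficiency e (S :\: nbhd e S))%R.
Proof.
have sub : nbhd e (S :\: nbhd e S) \subset nbhd e S :\: S.
  apply/subsetP => j; rewrite inE => /existsP[i /andP[]].
  rewrite inE => /andP[iN iS] eji; rewrite inE; apply/andP; split.
    apply: contra iN => jS; rewrite inE; apply/existsP; exists j.
    by rewrite jS e_sym.
  by rewrite inE; apply/existsP; exists i; rewrite iS.
have := subset_leq_card sub; rewrite /deficiency.
have := cardsID S (nbhd e S); have := cardsID (nbhd e S) S.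
by rewrite (setIC (nbhd e S)); lia.
Qed.

Lemma deficiency_lt_OEI (S : {set V}) :
  connected_graph e -> (exists u v, e u v) ->
  (deficiency e S + 1 <= Posz (OEI e))%R.
Proof.
move=> e_conn e_edge.
have e_nbr x := connected_no_isolated x e_conn e_edge.
have := deficiency_independent_part S; have := @independent_part S.
move: (S :\: nbhd e S) => I I_ind leSI.
have leI : (#|I| <= OEI e)%N by apply: leq_card_independent_OEI.
case: (set_0Vmem I) => [I0|[x xI]].
  (* The empty set has deficiency 0, so any singleton, being independent, is enough. *)
  have [u _] := e_edge.
  have le1 : (#|[set u]| <= OEI e)%N.
    apply: leq_card_independent_OEI => // a b.
    by rewrite !inE => /eqP-> /eqP->; rewrite e_irr.
  move: leSI le1; rewrite /deficiency I0 cards0 cards1; lia.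
have N_gt0 : (0 < #|nbhd e I|)%N.
  have [y exy] := e_nbr x; apply/card_gt0P; exists y.
  by rewrite inE; apply/existsP; exists x; rewrite xI e_sym.
by move: leSI leI N_gt0; rewrite /deficiency; lia.
Qed.

End Bounds.

Theorem proposition1p2 (V : finType) (e : rel V)
    (e_sym : symmetric e) (e_irr : irreflexive e)
    (e_conn : connected_graph e) (e_edge : exists u v : V, e u v) :
  (uphalf (#|V| - 1) <= OEI e)%N /\
  (delta e + 1 <= Posz (OEI e))%R.
Proof.
split; first exact: leq_uphalf_OEI.
exact: deficiency_lt_OEI.
Qed.
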